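(* Consider the inexact Rayleigh quotient iteration for a Hermitian matrix $A$ described in the context, with an arbitrary solver for the inner linear systems. Suppose that the uniform positiveness condition $$|\cos\phi_k+\xi_k\cos\psi_k|\ge c$$ is satisfied with a constant $c>0$ uniformly independent of $k$. Then $$\tan\phi_{k+1}\le 2\beta\,\frac{\sin\phi_k+\xi_k\sin\psi_k}{|\cos\phi_k+\xi_k\cos\psi_k|}\,\sin^2\phi_k\le \frac{2\beta\xi_k}{c}\sin^2\phi_k+O(\sin^3\phi_k),$$ that is, the inexact Rayleigh quotient iteration converges at least quadratically ($\tan\phi_{k+1}=O(\sin^2\phi_k)$) for uniformly bounded $\xi_k\le\xi$ with $\xi$ some moderate constant (not required to be less than one).
   Context: Setting. $A\in\mathbb{C}^{n\times n}$ is Hermitian with eigenvalues $\lambda=\lambda_1,\lambda_2,\ldots,\lambda_n$ and corresponding orthonormal eigenvectors $x=x_1,x_2,\ldots,x_n$; $(\lambda,x)$ is the desired eigenpair. $\lambda_{\min},\lambda_{\max}$ are the smallest and largest eigenvalues of $A$, $\|\cdot\|$ is the Euclidean norm, and $$\beta=\frac{\lambda_{\max}-\lambda_{\min}}{|\lambda_2-\lambda|}.$$ Inexact Rayleigh quotient iteration (RQI): given a unit vector $u_k$, put $\theta_k=u_k^*Au_k$; compute an approximate solution $w_{k+1}$ of $(A-\theta_kI)w=u_k$, so that $$(A-\theta_kI)w_{k+1}=u_k+\xi_kd_k,\qquad \|d_k\|=1,$$ where $\xi_k\ge 0$ is the (relative) residual norm and $d_k$ the residual direction; then set $u_{k+1}=w_{k+1}/\|w_{k+1}\|$.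 Standing assumption: $u_k$ is a reasonably good approximation to $x$ in the sense that, for every $k$ considered, $|\lambda-\theta_k|<|\lambda_2-\theta_k|\le\cdots\le|\lambda_n-\theta_k|$ and $|\lambda-\theta_k|<\tfrac12|\lambda-\lambda_2|$. Angles: $\phi_k=\angle(u_k,x)$ is the acute angle between $u_k$ and $x$, and $\psi_k=\angle(d_k,x)\in[0,\pi]$; one writes the orthogonal decompositions $u_k=x\cos\phi_k+e_k\sin\phi_k$ with $e_k\perp x$, $\|e_k\|=1$, and $d_k=x\cos\psi_k+f_k\sin\psi_k$ with $f_k\perp x$, $\|f_k\|=1$ (the coefficients along $x$ being taken real). $O(\cdot)$ is as $\sin\phi_k\to0$, with constant independent of $k$. *)

(* Defs.v *)
(* MathComp / MathComp-Analysis; the complex numbers are R[i] for R : realType. *)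
From HB Require Import structures.
From mathcomp Require Import all_boot all_order all_algebra.
From mathcomp Require Import all_classical all_reals all_analysis.
From mathcomp Require Import complex.

Set Implicit Arguments.
Unset Strict Implicit.
Unset Printing Implicit Defensive.

Import Order.TTheory GRing.Theory Num.Theory.
Import ComplexField.Normc.

Local Open Scope ring_scope.
Local Open Scope complex_scope.
Local Open Scope sesquilinear_scope.

Section Geometry.
Variables (R : realType) (m : nat).
Implicit Types u v y : 'cV[R[i]]_m.

Definition dotc u v : R[i] := (u ^t* *m v) 0 0.

Definition enorm v : R := Num.sqrt (\sum_i normc (v i 0) ^+ 2).

Definition acute_angle u v : R := acos (normc (dotc u v) / (enorm u * enorm v)).

(* The sign of the real part of the inner product is kept: values in [0, pi]. *)
Definition angle u v : R :=
  acos (complex.Re (dotc u v) / (enorm u * enorm v)).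

(* Since t is real, this forces the coefficient of v along y to be real. *)
Definition orth_decomp v y (t : R) : Prop :=
  exists e, [/\ dotc y e = 0, enorm e = 1 &
                v = (cos t)%:C *: y + (sin t)%:C *: e].

Definition rayleigh (A : 'M[R[i]]_m) u : R[i] := dotc u (A *m u).

End Geometry.

(* The dimension is n.+2, so that a second eigenvalue exists. *)
Section InexactRQI.
Variables (R : realType) (n : nat).
Local Notation vec := 'cV[R[i]]_n.+2.
Implicit Types (A : 'M[R[i]]_n.+2) (lam : 'I_n.+2 -> R) (x : 'I_n.+2 -> vec).

Definition i1 : 'I_n.+2 := ord0.
Definition i2 : 'I_n.+2 := lift ord0 ord0.

Definition orthonormal_eigenbasis A lam x : Prop :=
  (forall i, A *m x i = (lam i)%:C *: x i) /\
  (forall i j, dotc (x i) (x j) = (i == j)%:R).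

Definition lam_max lam : R := \big[Num.max/lam i1]_i lam i.
Definition lam_min lam : R := \big[Num.min/lam i1]_i lam i.

Definition beta lam : R := (lam_max lam - lam_min lam) / `|lam i2 - lam i1|.

(* theta is the current Rayleigh quotient. *)
Definition good_shift lam (theta : R[i]) : Prop :=
  let dist i := normc ((lam i)%:C - theta) in
  [/\ dist i1 < dist i2,
      forall i j : 'I_n.+2, (0 < i <= j)%N -> dist i <= dist j &
      dist i1 < 2^-1 * `|lam i1 - lam i2|].

Section Sequences.
Variables (x1 : vec) (u d : nat -> vec) (xi : nat -> R) (s : nat -> R[i]).

Definition phi k : R := acute_angle (u k) x1.
Definition psi k : R := angle (d k) (s k *: x1).

(* K is the set of steps k considered (finite or infinite).  The unit
   eigenvector for lam i1 is only determined up to a phase, and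
   u k.+1 = w k.+1 / |w k.+1| may change the phase of the component of the
   iterate along x i1 (already its sign, in exact arithmetic).  The unimodular
   s k selects the representative s k *: x i1 along which u k has the
   coefficient cos (phi k) >= 0; s = 1 is the case of a fixed x i1. *)
Definition inexact_RQI A lam (K : set nat) (w : nat -> vec) : Prop :=
  forall k, K k ->
  let theta := rayleigh A (u k) in
  [/\ enorm (u k) = 1,
      [/\ (A - theta%:M) *m w k.+1 = u k + (xi k)%:C *: d k,
          0 <= xi k,
          enorm (d k) = 1 &
          u k.+1 = ((enorm (w k.+1))^-1)%:C *: w k.+1],
      good_shift lam theta &
      [/\ normc (s k) = 1,
          orth_decomp (u k) (s k *: x1) (phi k) &
          orth_decomp (d k) (s k *: x1) (psi k)]].

Definition uniform_positiveness (K : set nat) (c : R) : Prop :=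
  forall k, K k -> c <= `|cos (phi k) + xi k * cos (psi k)|.

End Sequences.

End InexactRQI.

(* Main.v *)
Require Import Defs.
From HB Require Import structures.
From mathcomp Require Import all_boot all_order all_algebra.
From mathcomp Require Import all_classical all_reals all_analysis.
From mathcomp Require Import complex ring lra.

Set Implicit Arguments.
Unset Strict Implicit.
Unset Printing Implicit Defensive.

Import Order.TTheory GRing.Theory Num.Theory.
Import ComplexField.Normc.

Local Open Scope ring_scope.
Local Open Scope complex_scope.

(** Everything is read off in coordinates along the eigenbasis, where Euclidean
norms are sums of squared moduli ([enorm_parseval]).  If w has coordinate a
along the target eigenvector and the rest of w has norm b, then the tangent of
the angle between w and that eigenvector is b / |a| ([tan_acute_angle]).

Write theta for the Rayleigh quotient of the current iterate u and lambda for
the target eigenvalue.  The operator A - theta multiplies the j-th coordinate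
by lambda_j - theta, so solving (A - theta) w = u + xi d divides the target
coordinate of the right-hand side by lambda - theta and the norm of the
remaining part by at least |lambda_2 - theta|, the smallest of the other
distances ([perp_shifted_solve]).  In terms of the angles, the target coordinate of
u + xi d has modulus |cos phi + xi cos psi|, and the part orthogonal to the
target is sin phi e + xi sin psi f with unit e and f, of norm at most
sin phi + xi sin psi ([enorm_unit_comb]).  Hence the new tangent is at most

  |lambda - theta| / |lambda_2 - theta|
    * (sin phi + xi sin psi) / |cos phi + xi cos psi|.

The second-order factor comes from the shift: theta is the average of the
eigenvalues with the squared coordinates of u as weights, so lambda - theta
only sees the weight sin^2 phi lying off the target, and is at most the spread
of the spectrum times sin^2 phi ([rayleigh_error]).  As theta is closer to lambda
than half the gap, |lambda_2 - theta| is at least half the gap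
([good_shift_gap]); the quotient of spread and half gap is 2 beta, which gives
the first inequality ([RQI_step_le]).

Bounding sin psi by 1 and the denominator below by c then gives both the
expansion with cubic remainder, with constant 2 beta / c, and quadratic
convergence for bounded xi. *)

(** * Hermitian geometry of complex vectors *)

Section Euclidean.
Variables (R : realType) (m : nat).
Implicit Types (u v y e f : 'cV[R[i]]_m) (z a : R[i]) (r p q t : R).

Lemma normCE z : `|z| = (normc z)%:C.
Proof. by case: z. Qed.

Lemma normc_ge0 z : 0 <= normc z.
Proof. by case: z => a b; apply: sqrtr_ge0. Qed.

Lemma normc_real r : normc r%:C = `|r|.
Proof. by rewrite /= expr0n/= addr0 sqrtr_sqr. Qed.

Lemma normc_conj z : normc z^*%R = normc z.
Proof. by apply: (@complexI R); rewrite -!normCE norm_conjC. Qed.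

Lemma normc_sqr z : (normc z ^+ 2)%:C = z^*%R * z.
Proof. by rewrite rmorphXn /= -normCE normCKC. Qed.

Lemma conj_real r : (r%:C)^*%R = r%:C.
Proof. exact: conjc_real. Qed.

Lemma dotcE u v : dotc u v = \sum_i (u i 0)^*%R * v i 0.
Proof. by rewrite /dotc mxE; apply: eq_bigr => i _; rewrite !mxE. Qed.

Lemma dotcDr u v y : dotc u (v + y) = dotc u v + dotc u y.
Proof. by rewrite /dotc mulmxDr mxE. Qed.

Lemma dotcZr a u v : dotc u (a *: v) = a * dotc u v.
Proof. by rewrite /dotc -scalemxAr mxE. Qed.

Lemma dotcC u v : dotc u v = (dotc v u)^*%R.
Proof.
rewrite !dotcE rmorph_sum; apply: eq_bigr => i _ /=.
by rewrite rmorphM /= conjCK mulrC.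
Qed.

Lemma dotcZl a u v : dotc (a *: u) v = a^*%R * dotc u v.
Proof. by rewrite dotcC dotcZr rmorphM /= -dotcC. Qed.

Lemma dotc_hermitian (A : 'M[R[i]]_m) u v :
  A \is hermsymmx -> dotc u (A *m v) = dotc (A *m u) v.
Proof.
move=> /is_hermitianmxP; rewrite expr0 scale1r => hA.
by rewrite /dotc {1}hA trmx_mul map_mxM mulmxA.
Qed.

Lemma enorm_ge0 v : 0 <= enorm v.
Proof. exact: sqrtr_ge0. Qed.

Lemma sqr_enorm v : enorm v ^+ 2 = \sum_i normc (v i 0) ^+ 2.
Proof. by rewrite sqr_sqrtr// sumr_ge0// => i _; apply: sqr_ge0. Qed.

Lemma dotcvv v : dotc v v = (enorm v ^+ 2)%:C.
Proof.
rewrite dotcE sqr_enorm rmorph_sum; apply: eq_bigr => i _.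
by rewrite /= normc_sqr.
Qed.

Lemma enormZ a v : enorm (a *: v) = normc a * enorm v.
Proof.
apply/eqP; rewrite -(@eqrXn2 _ 2)// ?mulr_ge0 ?enorm_ge0 ?normc_ge0//.
rewrite exprMn !sqr_enorm mulr_sumr; apply/eqP/eq_bigr => i _.
by rewrite mxE normcM exprMn.
Qed.

(** The cross term is controlled entrywise by 2ab <= a^2 + b^2.  This is the
triangle inequality already in the form needed for unit directions, where
weighting by p and q dispenses with Cauchy-Schwarz. *)
Lemma enorm_unit_comb p q e f : 0 <= p -> 0 <= q ->
  enorm e = 1 -> enorm f = 1 -> enorm (p%:C *: e + q%:C *: f) <= p + q.
Proof.
move=> p0 q0 e1 f1.
rewrite -(@ler_pXn2r _ 2) ?nnegrE ?enorm_ge0 ?addr_ge0//.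
have -> : (p + q) ^+ 2 =
    \sum_i (p * (p + q) * normc (e i 0) ^+ 2 + q * (p + q) * normc (f i 0) ^+ 2).
  by rewrite big_split /= -!mulr_sumr -!sqr_enorm e1 f1; ring.
rewrite sqr_enorm; apply: ler_sum => i _; rewrite !mxE.
set a := e i 0; set b := f i 0.
have tri : normc (p%:C * a + q%:C * b) <= p * normc a + q * normc b.
  by apply: le_trans (le_normcD _ _) _; rewrite !normcM !normc_real !ger0_norm.
apply: (@le_trans _ _ ((p * normc a + q * normc b) ^+ 2)).
  by rewrite ler_pXn2r ?nnegrE ?normc_ge0 ?addr_ge0 ?mulr_ge0 ?normc_ge0.
have : 0 <= p * q * (normc a - normc b) ^+ 2 by rewrite mulr_ge0 ?sqr_ge0 ?mulr_ge0.
by nra.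
Qed.

Lemma acute_angleZ r v y : 0 < r -> acute_angle (r%:C *: v) y = acute_angle v y.
Proof.
move=> r0; rewrite /acute_angle dotcZl normcM enormZ normc_conj normc_real.
by rewrite gtr0_norm// -[r * enorm v * enorm y]mulrA -mulf_div divff ?gt_eqF ?mul1r.
Qed.

(** This identifies the argument of [acos] in [angle] and [acute_angle] as
(the modulus of) a cosine, so that it lies in the range where [acos] inverts
[cos]. *)
Lemma orth_decomp_dotc v y t :
  enorm y = 1 -> orth_decomp v y t -> dotc y v = (cos t)%:C.
Proof.
move=> y1 [e [ye _ ->]].
by rewrite dotcDr !dotcZr ye dotcvv y1 expr1n mulr0 addr0 mulr1.
Qed.

Lemma sin_acos_ge0 t : -1 <= t <= 1 -> 0 <= sin (acos t).
Proof. by move=> t1; rewrite sin_ge0_pi ?acos_ge0 ?acos_lepi. Qed.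

Lemma sin_acute_angle_ge0 v y t : enorm v = 1 -> enorm y = 1 ->
  normc (dotc v y) = `|cos t| -> 0 <= sin (acute_angle v y).
Proof.
move=> v1 y1 vy; apply: sin_acos_ge0; rewrite vy v1 y1 mulr1 divr1.
rewrite ler_norml cos_geN1 cos_le1 /= andbT.
by rewrite (le_trans _ (normr_ge0 _))// lerN10.
Qed.

Lemma sin_angle_ge0 v y t : enorm v = 1 -> enorm y = 1 ->
  orth_decomp v y t -> 0 <= sin (angle v y).
Proof.
move=> v1 y1 vy; apply: sin_acos_ge0.
rewrite dotcC (orth_decomp_dotc y1 vy) conj_real v1 y1 mulr1 divr1 /=.
by rewrite cos_geN1 cos_le1.
Qed.

End Euclidean.

(** * Coordinates in an orthonormal basis *)

Section Coordinates.
Variables (R : realType) (n : nat).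
Local Notation vec := 'cV[R[i]]_n.+2.
Variable x : 'I_n.+2 -> vec.
Hypothesis x_orthonormal : forall i j, dotc (x i) (x j) = (i == j)%:R.
Implicit Types (u v w e : vec) (i j : 'I_n.+2) (r t : R).

(** For the matrix X with columns x i, orthonormality says X^* X = 1; as X is
square also X X^* = 1, which may be inserted between u^* and v. *)
Lemma dotc_parseval u v :
  dotc u v = \sum_i (dotc (x i) u)^*%R * dotc (x i) v.
Proof.
pose X : 'M[R[i]]_n.+2 := \matrix_(k, i) x i k 0.
have XE y : (X ^t Num.conj)%sesqui *m y = \col_i dotc (x i) y.
  apply/colP => i; rewrite !mxE dotcE; apply: eq_bigr => k _.
  by rewrite !mxE.
have XX : X *m (X ^t Num.conj)%sesqui = 1%:M.
  apply: mulmx1C; apply/matrixP => i j.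
  rewrite !mxE -x_orthonormal dotcE; apply: eq_bigr => k _.
  by rewrite !mxE.
rewrite /dotc -[v in LHS]mul1mx -XX -mulmxA XE mulmxA mxE.
apply: eq_bigr => i _; congr (_ * _); last by rewrite mxE.
rewrite mxE -dotcC dotcE; apply: eq_bigr => k _.
by rewrite !mxE.
Qed.

Lemma enorm_parseval v : enorm v ^+ 2 = \sum_i normc (dotc (x i) v) ^+ 2.
Proof.
apply: (@complexI R); rewrite -dotcvv dotc_parseval rmorph_sum.
by apply: eq_bigr => i _; rewrite /= normc_sqr.
Qed.

(** The norm of the orthogonal projection of v onto the complement of x i. *)
Definition perp i v : R := Num.sqrt (\sum_(j | j != i) normc (dotc (x j) v) ^+ 2).

Lemma perp_ge0 i v : 0 <= perp i v.
Proof. exact: sqrtr_ge0. Qed.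

Lemma sqr_perp i v :
  perp i v ^+ 2 = \sum_(j | j != i) normc (dotc (x j) v) ^+ 2.
Proof. by rewrite sqr_sqrtr// sumr_ge0// => j _; apply: sqr_ge0. Qed.

Lemma pythagoras i v :
  enorm v ^+ 2 = normc (dotc (x i) v) ^+ 2 + perp i v ^+ 2.
Proof. by rewrite enorm_parseval (bigD1 i)//= sqr_perp. Qed.

Lemma enorm_basis i : enorm (x i) = 1.
Proof.
apply/eqP; rewrite -(@eqrXn2 _ 2)// ?enorm_ge0// expr1n; apply/eqP.
by apply: (@complexI R); rewrite -dotcvv x_orthonormal eqxx.
Qed.

Lemma perpDl i a e : dotc (x i) e = 0 -> perp i (a *: x i + e) = enorm e.
Proof.
move=> e0; apply/eqP; rewrite -(@eqrXn2 _ 2)// ?perp_ge0 ?enorm_ge0//.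
rewrite (pythagoras i e) e0 /= expr0n /= add0r sqrtr0 expr0n add0r !sqr_perp.
apply/eqP/eq_bigr => j ji; rewrite dotcDr dotcZr x_orthonormal.
by rewrite (negbTE ji) mulr0 add0r.
Qed.

Lemma tan_acute_angle i v : 0 < normc (dotc (x i) v) ->
  tan (acute_angle v (x i)) = perp i v / normc (dotc (x i) v).
Proof.
move=> a0; have := pythagoras i v.
set a := normc _ in a0 *; set b := perp i v => nv.
have b0 : 0 <= b := perp_ge0 i v.
have v0 : 0 < enorm v.
  rewrite lt_neqAle enorm_ge0 andbT eq_sym -sqrf_eq0 nv gt_eqF//.
  by rewrite ltr_pwDl ?exprn_gt0 ?sqr_ge0.
have -> : acute_angle v (x i) = acos (a / enorm v).
  by rewrite /acute_angle dotcC normc_conj enorm_basis mulr1.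
have t1 : -1 <= a / enorm v <= 1.
  have t0 : 0 <= a / enorm v by rewrite divr_ge0 ?(ltW a0) ?(ltW v0).
  rewrite (le_trans _ t0) ?lerN10//= ler_pdivrMr// mul1r.
  by rewrite -(@ler_pXn2r _ 2) ?nnegrE ?(ltW a0) ?(ltW v0)// nv lerDl sqr_ge0.
rewrite /tan sin_acos// acosK// ?in_itv//=.
have -> : 1 - (a / enorm v) ^+ 2 = (b / enorm v) ^+ 2.
  rewrite !expr_div_n -[1](@divff _ (enorm v ^+ 2)) ?sqrf_eq0 ?gt_eqF//.
  by rewrite -mulrBl nv; congr (_ / _); ring.
rewrite sqrtr_sqr ger0_norm ?divr_ge0 ?(ltW v0)//.
by field; rewrite !gt_eqF.
Qed.

(** Dividing coordinates by numbers of modulus at least delta: the norm bound for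
the inverse of the shifted matrix on the complement of x i. *)
Lemma perp_shifted_solve i (mu : 'I_n.+2 -> R[i]) (delta : R) v w :
  0 < delta -> (forall j, j != i -> delta <= normc (mu j)) ->
  (forall j, mu j * dotc (x j) w = dotc (x j) v) -> perp i w <= perp i v / delta.
Proof.
move=> d0 mu_ge muw; rewrite ler_pdivlMr//.
rewrite -(@ler_pXn2r _ 2) ?nnegrE ?mulr_ge0 ?perp_ge0 ?(ltW d0)//.
rewrite exprMn !sqr_perp mulr_suml; apply: ler_sum => j ji.
rewrite -muw normcM exprMn mulrC ler_wpM2r ?sqr_ge0//.
by rewrite ler_pXn2r ?nnegrE ?normc_ge0 ?(ltW d0)// mu_ge.
Qed.

End Coordinates.

(** * One step of inexact Rayleigh quotient iteration *)

Section Spectral.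
Variables (R : realType) (n : nat) (A : 'M[R[i]]_n.+2).
Local Notation vec := 'cV[R[i]]_n.+2.
Variables (lam : 'I_n.+2 -> R) (x : 'I_n.+2 -> vec).
Hypothesis hA : A \is hermsymmx.
Hypothesis hx : orthonormal_eigenbasis A lam x.
Implicit Types (u v : vec) (i j : 'I_n.+2).

Lemma dotc_eigen i v : dotc (x i) (A *m v) = (lam i)%:C * dotc (x i) v.
Proof. by rewrite dotc_hermitian// (hx.1 i) dotcZl conj_real. Qed.

Lemma dotc_shift i (theta : R[i]) v :
  dotc (x i) ((A - theta%:M) *m v) = ((lam i)%:C - theta) * dotc (x i) v.
Proof.
by rewrite mulmxBl mul_scalar_mx -scaleNr dotcDr dotcZr dotc_eigen mulrBl mulNr.
Qed.

Lemma rayleighE u :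
  rayleigh A u = (\sum_i lam i * normc (dotc (x i) u) ^+ 2)%:C.
Proof.
rewrite /rayleigh (dotc_parseval hx.2) rmorph_sum; apply: eq_bigr => i _.
by rewrite dotc_eigen rmorphM /= normc_sqr mulrCA.
Qed.

Lemma lam_dist_le i j : `|lam i - lam j| <= lam_max lam - lam_min lam.
Proof.
have M k : lam_min lam <= lam k <= lam_max lam.
  by rewrite /lam_min /lam_max bigmin_le le_bigmax.
by have := M i; have := M j; rewrite ler_norml; lra.
Qed.

(** Since the squared coordinates of u sum to 1, lam i minus the Rayleigh
quotient is the average of lam i - lam j; its i-th term vanishes, and the
remaining weights sum to the square of [perp]. *)
Lemma rayleigh_error i u : enorm u = 1 ->
  normc ((lam i)%:C - rayleigh A u) <=
    (lam_max lam - lam_min lam) * perp x i u ^+ 2.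
Proof.
move=> u1; rewrite rayleighE -rmorphB normc_real.
have -> : lam i = \sum_j lam i * normc (dotc (x j) u) ^+ 2.
  by rewrite -mulr_sumr -(enorm_parseval hx.2) u1 expr1n mulr1.
rewrite -sumrB (bigD1 i)//= subrr add0r sqr_perp mulr_sumr.
apply: le_trans (ler_norm_sum _ _ _) _; apply: ler_sum => j _.
by rewrite -mulrBl normrM (ger0_norm (sqr_ge0 _)) ler_wpM2r ?sqr_ge0 ?lam_dist_le.
Qed.

Lemma beta_ge0 : 0 <= beta lam.
Proof. by rewrite divr_ge0// (le_trans _ (lam_dist_le (i1 n) (i1 n))). Qed.

(** A shift within half the gap of the target eigenvalue stays at least half the
gap away from lam i2, and no other eigenvalue is closer to it than lam i2. *)
Lemma good_shift_gap theta : good_shift lam theta ->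
  [/\ 0 < 2^-1 * `|lam (i2 n) - lam (i1 n)|,
      2^-1 * `|lam (i2 n) - lam (i1 n)| <= normc ((lam (i2 n))%:C - theta) &
      forall j, j != i1 n ->
        normc ((lam (i2 n))%:C - theta) <= normc ((lam j)%:C - theta)].
Proof.
move=> [_ mono near]; split.
- by rewrite distrC (le_lt_trans _ near)// normc_ge0.
- have : `|lam (i2 n) - lam (i1 n)| <=
      normc ((lam (i2 n))%:C - theta) + normc ((lam (i1 n))%:C - theta).
    have -> : `|lam (i2 n) - lam (i1 n)| =
        normc (((lam (i2 n))%:C - theta) + - ((lam (i1 n))%:C - theta)).
      by rewrite -normc_real rmorphB opprB addrA subrK.
    by rewrite (le_trans (le_normcD _ _))// normcN.
  by move: near; rewrite /= (distrC (lam (i1 n))); lra.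
- move=> j j1; apply: mono.
  by move: j1; rewrite -val_eqE /= /bump /= -lt0n => ->.
Qed.

(** The unnormalized solution w already makes the angle of the next iterate with
the eigenvector; 0 < enorm w makes its normalization a positive rescaling. *)
Lemma RQI_step_le u d w (xi phi psi : R) (s : R[i]) :
  enorm u = 1 -> good_shift lam (rayleigh A u) -> normc s = 1 ->
  orth_decomp u (s *: x (i1 n)) phi -> orth_decomp d (s *: x (i1 n)) psi ->
  0 <= sin phi -> 0 <= sin psi -> 0 <= xi ->
  (A - (rayleigh A u)%:M) *m w = u + xi%:C *: d ->
  0 < `|cos phi + xi * cos psi| ->
  tan (acute_angle w (x (i1 n))) <=
    2 * beta lam * ((sin phi + xi * sin psi) / `|cos phi + xi * cos psi|) *
    sin phi ^+ 2 /\ 0 < enorm w.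
Proof.
set x1 := x (i1 n); set theta := rayleigh A u.
move=> u1 shift s1 du dd sphi spsi xi0 solve C0.
have x1_unit : enorm x1 = 1 := enorm_basis hx.2 _.
have y1 : enorm (s *: x1) = 1 by rewrite enormZ s1 x1_unit mulr1.
have s0 : s^*%R != 0.
  apply/eqP => s0; move: s1; rewrite -normc_conj s0 normc0 => /esym/eqP.
  by rewrite oner_eq0.
set C := `|_| in C0 *; set S := sin phi + xi * sin psi.
have S0 : 0 <= S by rewrite addr_ge0 ?mulr_ge0.
(* The representative s *: x1 of the eigenvector makes both target coordinates
   real; passing back to x1 costs a unimodular factor. *)
have yb : dotc (s *: x1) (u + xi%:C *: d) = (cos phi + xi * cos psi)%:C.
  rewrite dotcDr dotcZr (orth_decomp_dotc y1 du) (orth_decomp_dotc y1 dd).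
  by rewrite rmorphD rmorphM.
have x1b : normc (dotc x1 (u + xi%:C *: d)) = C.
  by rewrite /C -normc_real -yb dotcZl normcM normc_conj s1 mul1r.
have perp_e e : dotc (s *: x1) e = 0 -> dotc x1 e = 0.
  by rewrite dotcZl => /eqP; rewrite mulf_eq0 (negbTE s0) => /eqP.
have perp_u : perp x (i1 n) u = sin phi.
  case: du => e [/perp_e e0 e1 ->].
  rewrite scalerA perpDl ?enormZ ?normc_real ?e1 ?mulr1 ?ger0_norm//.
    exact: hx.2.
  by rewrite dotcZr e0 mulr0.
have perp_b : perp x (i1 n) (u + xi%:C *: d) <= S.
  case: du dd => e [/perp_e e0 e1 ->] [f [/perp_e f0 f1 ->]].
  rewrite scalerDr !scalerA addrACA -scalerDl perpDl.
  - by rewrite -rmorphM enorm_unit_comb ?mulr_ge0.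
  - exact: hx.2.
  - by rewrite dotcDr !dotcZr e0 f0 !mulr0 addr0.
have [gap0 gap2 gapj] := good_shift_gap shift.
set gap := 2^-1 * _ in gap0 gap2.
have coefE j : ((lam j)%:C - theta) * dotc (x j) w = dotc (x j) (u + xi%:C *: d).
  by rewrite -dotc_shift solve.
have perp_w : perp x (i1 n) w <= S / gap.
  have gap_le j : j != i1 n -> gap <= normc ((lam j)%:C - theta).
    by move=> /gapj; apply: le_trans.
  have /le_trans -> // := perp_shifted_solve gap0 gap_le coefE.
  by rewrite ler_wpM2r// invr_ge0 ltW.
set m1 := normc ((lam (i1 n))%:C - theta).
have m1E : m1 * normc (dotc x1 w) = C by rewrite -normcM coefE x1b.
(* The shift is not the target eigenvalue: the target coordinate of the
   right-hand side would vanish. *)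
have m1_0 : 0 < m1.
  rewrite lt_neqAle normc_ge0 andbT eq_sym; apply/eqP => z.
  by move: C0; rewrite -m1E z mul0r ltxx.
have m1_le : m1 <= (lam_max lam - lam_min lam) * sin phi ^+ 2.
  by rewrite -perp_u; apply: rayleigh_error.
have x1wE : normc (dotc x1 w) = C / m1 by rewrite -m1E mulrC mulKf ?gt_eqF.
have x1w0 : 0 < normc (dotc x1 w) by rewrite x1wE divr_gt0.
split; last first.
  rewrite lt_neqAle enorm_ge0 andbT eq_sym -sqrf_eq0 (pythagoras hx.2 (i1 n)).
  by rewrite gt_eqF// ltr_pwDl ?exprn_gt0 ?sqr_ge0.
rewrite (tan_acute_angle hx.2)//.
apply: (@le_trans _ _ (S / gap * (m1 / C))).
  by rewrite x1wE invf_div ler_wpM2r// divr_ge0 ?(ltW m1_0) ?(ltW C0).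
have -> : 2 * beta lam * (S / C) * sin phi ^+ 2 =
    S / gap * ((lam_max lam - lam_min lam) * sin phi ^+ 2 / C).
  rewrite /beta /gap; move: gap0; rewrite /gap; set g := `|_| => g0.
  by field; rewrite !gt_eqF//; lra.
apply: ler_wpM2l; first by rewrite divr_ge0 ?(ltW gap0).
by rewrite ler_pM2r ?invr_gt0.
Qed.

End Spectral.

(** * Quadratic convergence *)

Theorem theorem2 (R : realType) (n : nat) (A : 'M[R[i]]_n.+2)
    (lam : 'I_n.+2 -> R) (x : 'I_n.+2 -> 'cV[R[i]]_n.+2) (c : R)
    (hA : A \is hermsymmx)
    (hx : orthonormal_eigenbasis A lam x)
    (hc : 0 < c) :
  (exists M : R,
    forall (K : set nat) (u d w : nat -> 'cV[R[i]]_n.+2) (xi : nat -> R)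
           (s : nat -> R[i]),
      let ph := phi (x (i1 n)) u in
      let ps := psi (x (i1 n)) d s in
      inexact_RQI (x (i1 n)) u d xi s A lam K w ->
      uniform_positiveness (x (i1 n)) u d xi s K c ->
      forall k, K k ->
        let bound := 2 * beta lam *
          ((sin (ph k) + xi k * sin (ps k)) /
           `|cos (ph k) + xi k * cos (ps k)|) * sin (ph k) ^+ 2 in
        tan (ph k.+1) <= bound /\
        bound <= 2 * beta lam * xi k / c * sin (ph k) ^+ 2
                 + M * sin (ph k) ^+ 3)
  /\
  (forall xibar : R, exists M : R,
    forall (K : set nat) (u d w : nat -> 'cV[R[i]]_n.+2) (xi : nat -> R)
           (s : nat -> R[i]),
      let ph := phi (x (i1 n)) u in
      inexact_RQI (x (i1 n)) u d xi s A lam K w ->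
      uniform_positiveness (x (i1 n)) u d xi s K c ->
      (forall k, K k -> xi k <= xibar) ->
      forall k, K k -> tan (ph k.+1) <= M * sin (ph k) ^+ 2).
Proof.
have b0 : 0 <= 2 * beta lam := mulr_ge0 (ler0n _ 2) (beta_ge0 lam).
set x1 := x (i1 n).
have x1_unit : enorm x1 = 1 := enorm_basis hx.2 _.
have facts (K : set nat) u d w xi s : 
    inexact_RQI x1 u d xi s A lam K w ->
    uniform_positiveness x1 u d xi s K c -> forall k, K k ->
    let ph := phi x1 u in let ps := psi x1 d s in
    [/\ 0 <= sin (ph k), sin (ph k) <= 1, 0 <= xi k,
     tan (ph k.+1) <= 2 * beta lam *
          ((sin (ph k) + xi k * sin (ps k)) /
           `|cos (ph k) + xi k * cos (ps k)|) * sin (ph k) ^+ 2 &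
     (sin (ph k) + xi k * sin (ps k)) / `|cos (ph k) + xi k * cos (ps k)|
       <= xi k / c + sin (ph k) / c].
  move=> rqi pos k Kk ph ps.
  have [u1 [solve xi0 d1 uE] shift [s1 du dd]] := rqi k Kk.
  have C_ge : c <= `|cos (ph k) + xi k * cos (ps k)| := pos k Kk.
  have C0 := lt_le_trans hc C_ge.
  have y1 : enorm (s k *: x1) = 1 by rewrite enormZ s1 x1_unit mulr1.
  have sph : 0 <= sin (ph k).
    apply: (@sin_acute_angle_ge0 _ _ _ _ (ph k)) => //.
    rewrite -normc_real -(orth_decomp_dotc y1 du) dotcZl normcM normc_conj s1.
    by rewrite mul1r dotcC normc_conj.
  have sps : 0 <= sin (ps k) := sin_angle_ge0 d1 y1 dd.
  have [tan_w w0] := RQI_step_le hA hx u1 shift s1 du dd sph sps xi0 solve C0.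
  split => //.
  - by rewrite /ph /phi uE acute_angleZ ?invr_gt0.
  - rewrite -mulrDl addrC; apply: ler_pM => //.
    + by rewrite addr_ge0 ?mulr_ge0.
    + by rewrite lerD2r ler_piMr ?sin_le1.
    + by rewrite lef_pV2.
split; [exists (2 * beta lam / c)
      | move=> xibar; exists (2 * beta lam * ((xibar + 1) / c))].
- move=> K u d w xi s ph ps rqi pos k Kk bound.
  have [sph _ xi0 tan_le ratio_le] := facts _ _ _ _ _ _ rqi pos k Kk.
  split=> //; rewrite /bound.
  apply: (@le_trans _ _
    (2 * beta lam * (xi k / c + sin (ph k) / c) * sin (ph k) ^+ 2)).
    by rewrite ler_wpM2r ?sqr_ge0// ler_wpM2l.
  by rewrite le_eqVlt; apply/orP; left; apply/eqP; ring.
- move=> K u d w xi s ph rqi pos xi_le k Kk.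
  have [sph sph1 xi0 tan_le ratio_le] := facts _ _ _ _ _ _ rqi pos k Kk.
  apply: le_trans tan_le _.
  rewrite ler_wpM2r ?sqr_ge0// ler_wpM2l//.
  apply: le_trans ratio_le _; rewrite -mulrDl ler_wpM2r ?invr_ge0 ?(ltW hc)//.
  by rewrite lerD// xi_le.
Qed.
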